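(* Let $d\in\{2,3\}$, let $\mathcal O\subset\mathbb R^d$ be a bounded domain with $C^2$ boundary, and let $A(x)$, $x\in\overline{\mathcal O}$, be a smooth symmetric ($A=A^t$) matrix function with complex entries which is elliptic at every $x\in\overline{\mathcal O}$. Then the interior transmission problem $$\Delta u+k^2u=0,\quad \nabla\cdot A\nabla v+k^2n(x)v=0\ \text{ in }\mathcal O,\qquad u-v=f,\quad \frac{\partial u}{\partial\nu}-\nu\cdot A\nabla v=g\ \text{ on }\partial\mathcal O$$ satisfies the Shapiro–Lopatinskii condition (as spelled out in the context) if and only if the following holds at each point $x^0\in\partial\mathcal O$: (i) if $d=2$: at least one of the two conditions $\det A(x^0)\neq 1$ or $\operatorname{Re}a_{2,2}(x^0)<0$ holds; (ii) if $d=3$: at least one of the two conditions holds: $\det B(x^0,\tau)\neq 1$ for all unit vectors $\tau\in\mathbb R^2$, or $\operatorname{Re}a_{3,3}(x^0)<0$.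
   Context: Here $n$ is a smooth complex valued function on $\overline{\mathcal O}$, $k\in\mathbb C$, and $\nu$ is the outward unit normal on $\partial\mathcal O$. Ellipticity of $A$ at $x$. If $d\ge 3$: $\xi\cdot A(x)\xi\ne0$ for all $0\neq\xi\in\mathbb R^d$ (bilinear dot product, no conjugation). If $d=2$: for any two linearly independent $\xi^{(1)},\xi^{(2)}\in\mathbb R^2$, the quadratic equation $(\xi^{(1)}+\lambda\xi^{(2)})\cdot A(x)(\xi^{(1)}+\lambda\xi^{(2)})=0$ in $\lambda$ has one root with positive imaginary part and one root with negative imaginary part. Local coefficients. For $x^0\in\partial\mathcal O$ choose an orthonormal basis $e_1,\dots,e_d$ of $\mathbb R^d$ with $e_d=\nu(x^0)$ (so $e_1,\dots,e_{d-1}$ are tangent to $\partial\mathcal O$ at $x^0$) and put $a_{i,j}=a_{i,j}(x^0)=e_j\cdot A(x^0)e_i$. For $d=3$ and $\tau=(\tau_1,\tau_2)\in\mathbb R^2$, $$B=B(x^0,\tau)=\begin{pmatrix}\sum_{i,j=1}^2a_{i,j}\tau_i\tau_j & a_{1,3}\tau_1+a_{2,3}\tau_2\\ a_{1,3}\tau_1+a_{2,3}\tau_2& a_{3,3}\end{pmatrix}.$$ Shapiro–Lopatinskii condition for this problem: for every $x^0\in\partial\mathcal O$ and every $\tau\in\mathbb R^{d-1}\setminus\{0\}$, the only pair of functions $(\widehat u,\widehat v)$ on $[0,\infty)$ with $\widehat u(t),\widehat v(t)\to0$ as $t\to\infty$ satisfying $$\widehat u''-|\tau|^2\widehat u=0,\qquad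 a_{d,d}\widehat v''+2i\Big(\sum_{j=1}^{d-1}a_{j,d}\tau_j\Big)\widehat v'-\Big(\sum_{i,j=1}^{d-1}a_{i,j}\tau_i\tau_j\Big)\widehat v=0\quad (t>0),$$ $$\widehat u(0)-\widehat v(0)=0,\qquad \widehat u'(0)-\Big(i\sum_{j=1}^{d-1}a_{j,d}\tau_j\,\widehat v(0)+a_{d,d}\widehat v'(0)\Big)=0$$ is $(\widehat u,\widehat v)=(0,0)$. (This is the problem obtained by freezing coefficients at $x^0$, keeping the principal terms, and Fourier transforming in the tangential variables.) *)

(* Defs.v *)
From HB Require Import structures.
From mathcomp Require Import all_boot all_order all_algebra.
From mathcomp Require Import all_classical all_reals all_analysis.
From mathcomp Require Export complex.

Set Implicit Arguments.
Unset Strict Implicit.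
Unset Printing Implicit Defensive.

Import Order.TTheory GRing.Theory Num.Theory.
Import numFieldNormedType.Exports.

Local Open Scope classical_set_scope.
Local Open Scope ring_scope.

(* The ambient dimension is d = m.+1 throughout, so that m = d - 1 is the number
   of tangential directions. Points and vectors are rows. The library norm of a
   row is the sup norm, so Euclidean lengths are written out as sums of squares. *)

Section Regularity.
Context {R : realType} {m : nat}.
Implicit Types (O U : set 'rV[R]_m.+1) (x : 'rV[R]_m.+1).

Definition partial (i : 'I_m.+1) (f : 'rV[R]_m.+1 -> R) (x : 'rV[R]_m.+1) : R :=
  'D_(delta_mx 0 i) f x.

Definition gradient (f : 'rV[R]_m.+1 -> R) (x : 'rV[R]_m.+1) : 'rV[R]_m.+1 :=
  \row_i partial i f x.

Fixpoint Ck_on U (k : nat) (f : 'rV[R]_m.+1 -> R) : Prop :=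
  (forall x, U x -> {for x, continuous f}) /\
  match k with
  | 0%N => True
  | k'.+1 => forall i : 'I_m.+1,
      (forall x, U x -> derivable f x (delta_mx 0 i)) /\ Ck_on U k' (partial i f)
  end.

(* Smoothness on the closed set closure O: f is there the restriction of a
   C^infinity function defined on a neighbourhood. Values of f elsewhere are
   irrelevant. *)
Definition smooth_on_closure O (f : 'rV[R]_m.+1 -> R[i]) : Prop :=
  exists U (g : 'rV[R]_m.+1 -> R[i]),
    [/\ open U, closure O `<=` U, (forall x, closure O x -> f x = g x) &
        forall k, Ck_on U k (fun x => complex.Re (g x)) /\
                  Ck_on U k (fun x => complex.Im (g x))].

Definition bdry O : set 'rV[R]_m.+1 := closure O `\` interior O.

Definition bounded_domain O : Prop :=
  [/\ O !=set0, open O, connected O & bounded_set O].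

Definition C2_defining_function O (x0 : 'rV[R]_m.+1)
    (phi : 'rV[R]_m.+1 -> R) : Prop :=
  exists U, [/\ open U, U x0, Ck_on U 2 phi, gradient phi x0 != 0 &
                forall x, U x -> (O x <-> phi x < 0)].

Definition C2_boundary O : Prop :=
  forall x0, bdry O x0 -> exists phi, C2_defining_function O x0 phi.

(* Since O is locally {phi < 0}, the gradient of phi points outwards; the
   normalized gradient does not depend on the choice of phi. *)
Definition outward_unit_normal O (x0 nu : 'rV[R]_m.+1) : Prop :=
  exists phi, C2_defining_function O x0 phi /\
    nu = (Num.sqrt (\sum_i gradient phi x0 0 i ^+ 2))^-1 *: gradient phi x0.

(* The rows of E are the orthonormal basis e_1, ..., e_d. *)
Definition adapted_basis O (x0 : 'rV[R]_m.+1) (E : 'M[R]_m.+1) : Prop :=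
  E *m E^T = 1%:M /\ outward_unit_normal O x0 (row ord_max E).

End Regularity.

Section Ellipticity.
Context {R : realType} {d : nat}.

Definition cplx (xi : 'rV[R]_d) : 'rV[R[i]]_d := map_mx (real_complex R) xi.

(* p . (A q) for the bilinear dot product, without conjugation. *)
Definition bilin (A : 'M[R[i]]_d) (p q : 'rV[R[i]]_d) : R[i] :=
  (p *m A *m q^T) 0 0.

(* Uniqueness of each root forces q to have degree exactly two; mere existence
   would also admit A with q identically zero. *)
Definition elliptic (A : 'M[R[i]]_d) : Prop :=
  ((3 <= d)%N -> forall xi : 'rV[R]_d, xi != 0 ->
     bilin A (cplx xi) (cplx xi) != 0) /\
  (d = 2%N -> forall xi1 xi2 : 'rV[R]_d, row_free (col_mx xi1 xi2) ->
     let q (l : R[i]) :=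
       bilin A (cplx xi1 + l *: cplx xi2) (cplx xi1 + l *: cplx xi2) in
     (exists! l : R[i], 0 < complex.Im l /\ q l = 0) /\
     (exists! l : R[i], complex.Im l < 0 /\ q l = 0)).

End Ellipticity.

Section FrozenProblem.
Context {R : realType} {m : nat}.

(* a_{i,j} = e_j . (A e_i) *)
Definition local_coef (A : 'M[R[i]]_m.+1) (E : 'M[R]_m.+1) : 'M[R[i]]_m.+1 :=
  \matrix_(i, j) bilin A (cplx (row j E)) (cplx (row i E)).

Implicit Types (a : 'M[R[i]]_m.+1) (tau : 'rV[R]_m).

(* Indices 1, ..., d-1 are the image of lift ord_max; the index d is ord_max. *)
Definition coef_nn a : R[i] := a ord_max ord_max.

Definition coef_tn a tau : R[i] :=
  \sum_(j < m) a (lift ord_max j) ord_max * (tau 0 j)%:C%C.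

Definition coef_tt a tau : R[i] :=
  \sum_(i < m) \sum_(j < m)
    a (lift ord_max i) (lift ord_max j) * (tau 0 i)%:C%C * (tau 0 j)%:C%C.

Definition Bmat a tau : 'M[R[i]]_(1 + 1) :=
  block_mx (coef_tt a tau)%:M (coef_tn a tau)%:M
           (coef_tn a tau)%:M (coef_nn a)%:M.

Definition sqnorm tau : R := \sum_(j < m) tau 0 j ^+ 2.

Definition diff_quot (w : R -> R[i]) (t h : R) : R[i] :=
  (h^-1)%:C%C * (w (t + h) - w t).

(* w is a function on [0, +oo[ with w' = w1 and w'' = w2 on ]0, +oo[, and with
   one-sided derivative w1 0 at 0; in particular w is right-continuous at 0. *)
Definition derivatives_on_halfline (w w1 w2 : R -> R[i]) : Prop :=
  [/\ diff_quot w 0 h @[h --> 0^'+] --> (w1 0 : R[i]^o),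
      forall t : R, 0 < t -> diff_quot w t h @[h --> 0^'] --> (w1 t : R[i]^o) &
      forall t : R, 0 < t -> diff_quot w1 t h @[h --> 0^'] --> (w2 t : R[i]^o)].

Definition frozen_solution a tau (u v : R -> R[i]) : Prop :=
  exists u1 u2 v1 v2 : R -> R[i],
    [/\ derivatives_on_halfline u u1 u2,
        derivatives_on_halfline v v1 v2,
        u t @[t --> +oo] --> (0 : R[i]^o) /\ v t @[t --> +oo] --> (0 : R[i]^o),
        forall t : R, 0 < t ->
          u2 t - (sqnorm tau)%:C%C * u t = 0 /\
          coef_nn a * v2 t + 2 * 'i%C * coef_tn a tau * v1 t
            - coef_tt a tau * v t = 0 &
        u 0 - v 0 = 0 /\
        u1 0 - ('i%C * coef_tn a tau * v 0 + coef_nn a * v1 0) = 0].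

(* Only the principal parts of the operators enter, so neither the lower-order
   data k, n nor the right-hand sides f, g are arguments. E x0 is the orthonormal
   basis chosen at the boundary point x0. *)
Definition shapiro_lopatinskii (O : set 'rV[R]_m.+1)
    (A : 'rV[R]_m.+1 -> 'M[R[i]]_m.+1) (E : 'rV[R]_m.+1 -> 'M[R]_m.+1) : Prop :=
  forall x0, bdry O x0 -> forall tau : 'rV[R]_m, tau != 0 ->
  forall u v : R -> R[i],
    frozen_solution (local_coef (A x0) (E x0)) tau u v ->
    forall t : R, 0 <= t -> u t = 0 /\ v t = 0.

End FrozenProblem.

(* Main.v *)
(** With tau fixed, the decaying solutions of the two frozen equations are
    u = c exp(-|tau| t) and v = c' exp(i l1 t), where l1 is the root with positive
    imaginary part of q(l) = a_dd l^2 + 2 (sum_j a_jd tau_j) l + sum_ij a_ij tau_i tau_j.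
    The boundary conditions leave a nonzero solution exactly when
    sum_j a_jd tau_j + a_dd l1 = i |tau|. The square of the left-hand side is -det B,
    so this forces det B = |tau|^2, and then the difference of the two roots is
    l1 - l2 = 2 i |tau| / a_dd or its opposite; since Im (l1 - l2) > 0, the sign is
    decided by the sign of Re a_dd.
    For d = 3, ellipticity only says that q has no real root. That the two roots lie
    on opposite sides of the real axis follows by deforming tau, through nonzero
    vectors, to a tau with Im (sum_j a_jd tau_j / a_dd) = 0, where the imaginary parts
    of the roots are opposite. *)
Require Import Defs.
From HB Require Import structures.
From mathcomp Require Import all_boot all_order all_algebra.
From mathcomp Require Import all_classical all_reals all_analysis.
From mathcomp Require Import ring lra.

Set Implicit Arguments.
Unset Strict Implicit.
Unset Printing Implicit Defensive.

Import Order.TTheory GRing.Theory Num.Theory.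
Import numFieldNormedType.Exports.

Local Open Scope classical_set_scope.
Local Open Scope ring_scope.

(** * Complex-valued functions of a real variable *)

Section ComplexAnalysis.
Context {R : realType}.
Implicit Types (z w : R[i]) (f g : R -> R[i]) (t : R).

Lemma cReD z w : complex.Re (z + w) = complex.Re z + complex.Re w.
Proof. by case: z w => [a b] [c d]. Qed.

Lemma cImD z w : complex.Im (z + w) = complex.Im z + complex.Im w.
Proof. by case: z w => [a b] [c d]. Qed.

Lemma cReN z : complex.Re (- z) = - complex.Re z.
Proof. by case: z. Qed.

Lemma cImN z : complex.Im (- z) = - complex.Im z.
Proof. by case: z. Qed.

Lemma cReM z w : complex.Re (z * w) =
  complex.Re z * complex.Re w - complex.Im z * complex.Im w.
Proof. by case: z w => [a b] [c d]. Qed.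

Lemma cImM z w : complex.Im (z * w) =
  complex.Re z * complex.Im w + complex.Im z * complex.Re w.
Proof. by case: z w => [a b] [c d]. Qed.

Definition complex_partsE := (cReD, cImD, cReN, cImN, cReM, cImM).

Lemma complex_eqP z w :
  complex.Re z = complex.Re w -> complex.Im z = complex.Im w -> z = w.
Proof. by case: z w => [a b] [c d] /= -> ->. Qed.

Lemma normc_Im_le z : `|complex.Im z|%:C%C <= `|z|.
Proof.
by rewrite normc_def lecR -sqrtr_sqr ler_sqrt ?addr_ge0 ?sqr_ge0// lerDr sqr_ge0.
Qed.

Lemma normc_le_parts z :
  `|z| <= (`|complex.Re z| + `|complex.Im z|)%:C%C.
Proof.
rewrite normc_def lecR.
rewrite -[leRHS]ger0_norm ?addr_ge0// -sqrtr_sqr ler_sqrt ?sqr_ge0//.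
rewrite sqrrD !real_normK ?num_real//.
have := mulr_ge0 (normr_ge0 (complex.Re z)) (normr_ge0 (complex.Im z)).
lra.
Qed.

Lemma cvg_complexP (T : Type) (F : set_system T) {FF : Filter F}
    (h : T -> R[i]) (l : R[i]) :
  h x @[x --> F] --> (l : R[i]^o) <->
  complex.Re (h x) @[x --> F] --> complex.Re l /\
  complex.Im (h x) @[x --> F] --> complex.Im l.
Proof.
split=> [/(@cvgrPdist_lt R[i] R[i]^o) hl|[/cvgrPdist_lt hR /cvgrPdist_lt hI]].
  split; apply/cvgrPdist_lt => e e0; have := hl e%:C%C;
    rewrite ltcR => /(_ e0); apply: filterS => x xe;
    rewrite -ltcR; apply: le_lt_trans xe; rewrite -?cReN -?cReD -?cImN -?cImD.
  - exact: normc_ge_Re.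
  - exact: normc_Im_le.
(* A positive element of [R[i]] has zero imaginary part, so the tolerance is a real [e], split
   evenly between the two parts. *)
apply/(@cvgrPdist_lt R[i] R[i]^o) => -[e e'] /=; rewrite ltcE /= => /andP[/eqP -> e0].
have e20 : 0 < e / 2 by rewrite divr_gt0.
near=> x; apply: le_lt_trans (normc_le_parts _) _.
rewrite complexr0 ltcR !complex_partsE (splitr e) ltrD//.
- by near: x; exact: hR.
- by near: x; exact: hI.
Unshelve. all: by end_near.
Qed.

Definition cexp z : R[i] :=
  Complex (expR (complex.Re z) * cos (complex.Im z))
          (expR (complex.Re z) * sin (complex.Im z)).

Lemma cexp0 : cexp 0 = 1.
Proof. by rewrite /cexp /= expR0 cos0 sin0 mulr1 mulr0. Qed.

Lemma cexpD z w : cexp (z + w) = cexp z * cexp w.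
Proof.
apply: complex_eqP; rewrite /cexp /= !complex_partsE /= expRD ?cosD ?sinD.
  by ring.
by ring.
Qed.

Lemma norm_cexp z : `|cexp z| = (expR (complex.Re z))%:C%C.
Proof.
rewrite normc_def /cexp /= !exprMn -mulrDr cos2Dsin2 mulr1 sqrtr_sqr.
by rewrite ger0_norm ?expR_ge0.
Qed.

(** The variable is real while the scalars of [R[i]^o] are complex, so differentiation is done on
    real and imaginary parts, where real calculus applies. *)
Definition cderiv f t (l : R[i]) : Prop :=
  is_derive t (1 : R) (fun s => complex.Re (f s)) (complex.Re l) /\
  is_derive t (1 : R) (fun s => complex.Im (f s)) (complex.Im l).

Lemma is_derive1P (h : R -> R) t (l : R) :
  is_derive t (1 : R) h l <->
  (x^-1 * (h (t + x) - h t)) @[x --> 0^'] --> l.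
Proof.
have E : (fun x : R => x^-1 *: (h (x *: (1 : R) + t) - h t)) =
         (fun x : R => x^-1 * (h (t + x) - h t)).
  by apply/funext => x; rewrite /GRing.scale /= mulr1 (addrC x).
split=> [dh|hl].
  by rewrite -E -(derive_val (is_derive := dh)); exact: (ex_derive (is_derive := dh)).
apply: DeriveDef; first by rewrite /derivable E; apply/cvg_ex; exists l.
by rewrite /derive E; apply: cvg_lim hl.
Qed.

Lemma cvg_diff_quotP f t (l : R[i]) :
  diff_quot f t h @[h --> 0^'] --> (l : R[i]^o) <-> cderiv f t l.
Proof.
rewrite cvg_complexP /cderiv !is_derive1P.
have -> : (fun x => complex.Re (diff_quot f t x)) =
    fun x => x^-1 * (complex.Re (f (t + x)) - complex.Re (f t)).
  by apply/funext => x; rewrite /diff_quot !complex_partsE /=; ring.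
have -> : (fun x => complex.Im (diff_quot f t x)) =
    fun x => x^-1 * (complex.Im (f (t + x)) - complex.Im (f t)).
  by apply/funext => x; rewrite /diff_quot !complex_partsE /=; ring.
by [].
Qed.

Lemma cderivM f g t (df dg : R[i]) : cderiv f t df -> cderiv g t dg ->
  cderiv (fun s => f s * g s) t (df * g t + f t * dg).
Proof.
move=> [fR fI] [gR gI]; split.
  rewrite (_ : (fun s => _) =
    (fun s => complex.Re (f s)) * (fun s => complex.Re (g s)) -
    (fun s => complex.Im (f s)) * (fun s => complex.Im (g s))); last first.
    by apply/funext => s; rewrite cReM.
  by apply: is_derive_eq; rewrite /GRing.scale /= !complex_partsE; ring.
rewrite (_ : (fun s => _) =
  (fun s => complex.Re (f s)) * (fun s => complex.Im (g s)) +
  (fun s => complex.Im (f s)) * (fun s => complex.Re (g s))); last first.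
  by apply/funext => s; rewrite cImM.
by apply: is_derive_eq; rewrite /GRing.scale /= !complex_partsE; ring.
Qed.

Lemma cderiv_cst (c : R[i]) t : cderiv (fun=> c) t 0.
Proof. by split; apply: is_derive_cst. Qed.

Lemma cderivB f g t (df dg : R[i]) : cderiv f t df -> cderiv g t dg ->
  cderiv (fun s => f s - g s) t (df - dg).
Proof.
move=> [fR fI] [gR gI]; split.
  rewrite (_ : (fun s => _) =
    (fun s => complex.Re (f s)) - (fun s => complex.Re (g s))); last first.
    by apply/funext => s; rewrite cReD cReN.
  by apply: is_derive_eq; rewrite cReD cReN.
rewrite (_ : (fun s => _) =
  (fun s => complex.Im (f s)) - (fun s => complex.Im (g s))); last first.
  by apply/funext => s; rewrite cImD cImN.
by apply: is_derive_eq; rewrite cImD cImN.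
Qed.

Lemma cderivZ (c : R[i]) f t (df : R[i]) : cderiv f t df ->
  cderiv (fun s => c * f s) t (c * df).
Proof.
by move=> /(cderivM (cderiv_cst c t)); rewrite mul0r add0r.
Qed.

Lemma cderiv_cexp (a : R[i]) t :
  cderiv (fun s => cexp (a * s%:C%C)) t (a * cexp (a * t%:C%C)).
Proof.
have lin (b : R) : is_derive t (1 : R) (fun s => b * s) b.
  have := is_deriveZ b (is_derive_id t (1 : R)).
  by rewrite /GRing.scale /= mulr1.
have E (s : R) : cexp (a * s%:C%C) =
  Complex (expR (complex.Re a * s) * cos (complex.Im a * s))
          (expR (complex.Re a * s) * sin (complex.Im a * s)).
  by rewrite /cexp !complex_partsE /= !mulr0 subr0 add0r.
have dexp := is_derive1_comp (is_derive_expR (complex.Re a * t))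
               (lin (complex.Re a)).
have dcos := is_derive1_comp (is_derive_cos (complex.Im a * t))
               (lin (complex.Im a)).
have dsin := is_derive1_comp (is_derive_sin (complex.Im a * t))
               (lin (complex.Im a)).
split.
  rewrite (_ : (fun s => _) =
    (expR \o (fun s => complex.Re a * s)) *
    (cos \o (fun s => complex.Im a * s))); last first.
    by apply/funext => s; rewrite E.
  by apply: is_derive_eq; rewrite E /GRing.scale /= !complex_partsE /=; ring.
rewrite (_ : (fun s => _) =
  (expR \o (fun s => complex.Re a * s)) *
  (sin \o (fun s => complex.Im a * s))); last first.
  by apply/funext => s; rewrite E.
by apply: is_derive_eq; rewrite E /GRing.scale /= !complex_partsE /=; ring.
Qed.

Lemma derive0_halfline_cst (h : R -> R) :
  (forall t, 0 < t -> is_derive t (1 : R) h 0) ->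
  forall s t, 0 < s -> s <= t -> h t = h s.
Proof.
move=> h0 s t s0 st.
have dh x : x \in `]s, t[ -> is_derive x (1 : R) h ((fun=> 0) x).
  by rewrite in_itv /= => /andP[/(lt_trans s0) x0 _]; exact: h0.
have ch : {within `[s, t], continuous h}.
  apply: derivable_within_continuous => x.
  rewrite in_itv /= => /andP[/(lt_le_trans s0) x0 _].
  by have [] := h0 x x0.
have [x _] := MVT_segment st dh ch.
by rewrite mul0r => /eqP; rewrite subr_eq0 => /eqP.
Qed.

Lemma cderiv0_halfline_cst f : (forall t, 0 < t -> cderiv f t 0) ->
  forall t, 0 < t -> f t = f 1.
Proof.
move=> f0 t t0.
have fR := @derive0_halfline_cst (fun s => complex.Re (f s))
             (fun x x0 => proj1 (f0 x x0)).
have fI := @derive0_halfline_cst (fun s => complex.Im (f s))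
             (fun x x0 => proj2 (f0 x x0)).
by have [t1|t1] := leP 1 t; [|symmetry]; apply: complex_eqP;
  (apply: fR || apply: fI); rewrite ?ltr01// ltW.
Qed.

(** Integrating factor: [f t * cexp (- b * t)] has zero derivative. The equation is known only for
    [0 < t], hence the reference point 1 instead of 0. *)
Lemma first_order_halfline f f1 (b : R[i]) :
  (forall t, 0 < t -> cderiv f t (f1 t)) ->
  (forall t, 0 < t -> f1 t = b * f t) ->
  exists c, forall t, 0 < t -> f t = c * cexp (b * t%:C%C).
Proof.
move=> df f1E.
have cst t : 0 < t ->
    f t * cexp (- b * t%:C%C) = f 1 * cexp (- b * 1%:C%C).
  move=> t0; apply: (@cderiv0_halfline_cst
    (fun t => f t * cexp (- b * t%:C%C))) => // s s0.
  have := cderivM (df s s0) (cderiv_cexp (- b) s); rewrite f1E//.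
  by congr (cderiv _ _ _); ring.
exists (f 1 * cexp (- b * 1%:C%C)) => t /cst <-.
by rewrite -mulrA -cexpD mulNr addNr cexp0 mulr1.
Qed.

End ComplexAnalysis.

(** * Decaying solutions on the half-line *)

Section HalflineODE.
Context {R : realType}.
Implicit Types (z w : R[i]) (f g : R -> R[i]) (t : R).

Lemma cvg_cexp_pinfty (a : R[i]) : complex.Re a < 0 ->
  cexp (a * t%:C%C) @[t --> +oo] --> (0 : R[i]^o).
Proof.
move=> a0; apply/(@cvgrPdist_lt R[i] R[i]^o) => -[e e'] /=.
rewrite ltcE /= => /andP[/eqP -> e0].
near=> t; rewrite sub0r normrN norm_cexp cReM /= mulr0 subr0.
(* Writing [e] as [expR (ln e)] leaves a linear inequality; dividing by the negative [complex.Re a]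
   turns it into a lower bound on [t]. *)
rewrite complexr0 ltcR -[ltRHS](@lnK _ e)// ltr_expR -ltr_ndivrMl//.
by near: t; apply: nbhs_pinfty_gt; rewrite num_real.
Unshelve. all: by end_near.
Qed.

Lemma cvg_complexM (T : Type) (F : set_system T) {FF : Filter F}
    (h k : T -> R[i]) (x y : R[i]) :
  h s @[s --> F] --> (x : R[i]^o) -> k s @[s --> F] --> (y : R[i]^o) ->
  h s * k s @[s --> F] --> (x * y : R[i]^o).
Proof. exact: (@cvgM R[i]). Qed.

Lemma cvg_complexB (T : Type) (F : set_system T) {FF : Filter F}
    (h k : T -> R[i]) (x y : R[i]) :
  h s @[s --> F] --> (x : R[i]^o) -> k s @[s --> F] --> (y : R[i]^o) ->
  h s - k s @[s --> F] --> (x - y : R[i]^o).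
Proof. exact: (@cvgB R[i] R[i]^o). Qed.

Lemma cvg_complexZ (T : Type) (F : set_system T) {FF : Filter F}
    (c : R[i]) (h : T -> R[i]) (x : R[i]) :
  h s @[s --> F] --> (x : R[i]^o) -> c * h s @[s --> F] --> (c * x : R[i]^o).
Proof. by apply: cvg_complexM; exact: (@cvg_cst R[i]^o). Qed.

Lemma cvg_complex_unique (T : Type) (F : set_system T) {FF : ProperFilter F}
    (h : T -> R[i]) (x y : R[i]) :
  h s @[s --> F] --> (x : R[i]^o) -> h s @[s --> F] --> (y : R[i]^o) -> x = y.
Proof. exact: (@cvg_unique R[i]^o (@norm_hausdorff R[i] R[i]^o)). Qed.

(** The increment [f (t + h) - f t] is [h] times a convergent quotient, so it tends to 0. *)
Lemma diff_quot_right_continuous f t (l : R[i]) :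
  diff_quot f t h @[h --> 0^'+] --> (l : R[i]^o) ->
  f (t + h) @[h --> 0^'+] --> (f t : R[i]^o).
Proof.
move=> fl.
have h0 : h%:C%C @[h --> (0 : R)^'+] --> (0 : R[i]^o).
  apply/cvg_complexP; split => /=.
    by apply: cvg_at_right_filter; exact: cvg_id.
  exact: cvg_cst.
have hf : h%:C%C * diff_quot f t h @[h --> (0 : R)^'+] --> (0 * l : R[i]^o).
  exact: cvg_complexM h0 fl.
have fN : (fun=> - f t) h @[h --> (0 : R)^'+] --> (- f t : R[i]^o).
  exact: (@cvg_cst R[i]^o).
have : h%:C%C * diff_quot f t h - (- f t) @[h --> (0 : R)^'+]
    --> (0 * l - (- f t) : R[i]^o).
  exact: cvg_complexB hf fN.
rewrite mul0r sub0r opprK; apply: cvg_trans; apply: near_eq_cvg; near=> h.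
rewrite /diff_quot mulrA -rmorphM/= divff ?mul1r ?opprK ?subrK//.
Unshelve. all: by end_near.
Qed.

Lemma diff_quot_at_right f t (l : R[i]) : cderiv f t l ->
  diff_quot f t h @[h --> 0^'+] --> (l : R[i]^o).
Proof. by move=> /cvg_diff_quotP; exact: (@cvg_dnbhs_at_right R R[i]^o). Qed.

(** Carries a formula found on the open half-line to the boundary data at 0: right continuity
    matches the values, and then the difference quotients coincide. *)
Lemma right_data_unique f g (f1 g1 : R[i]) :
  (forall t, 0 < t -> f t = g t) ->
  diff_quot f 0 h @[h --> 0^'+] --> (f1 : R[i]^o) ->
  diff_quot g 0 h @[h --> 0^'+] --> (g1 : R[i]^o) ->
  f 0 = g 0 /\ f1 = g1.
Proof.
move=> fg df dg.
have E : f 0 = g 0.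
  apply: (cvg_complex_unique (diff_quot_right_continuous df)).
  have := diff_quot_right_continuous dg.
  apply: cvg_trans; apply: near_eq_cvg; near=> h.
  by rewrite add0r fg//; near: h; exact: nbhs_right_gt.
split=> //; apply: (cvg_complex_unique df).
move: dg; apply: cvg_trans; apply: near_eq_cvg; near=> h.
rewrite /diff_quot add0r E fg//; near: h; exact: nbhs_right_gt.
Unshelve. all: by end_near.
Qed.

Lemma derivatives_cexp (a c : R[i]) :
  derivatives_on_halfline (fun t => c * cexp (a * t%:C%C))
    (fun t => c * (a * cexp (a * t%:C%C)))
    (fun t => c * (a * (a * cexp (a * t%:C%C)))).
Proof.
split=> [|t _|t _].
- by apply: diff_quot_at_right; apply: cderivZ; exact: cderiv_cexp.
- by apply/cvg_diff_quotP; apply: cderivZ; exact: cderiv_cexp.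
- by apply/cvg_diff_quotP; do 2 apply: cderivZ; exact: cderiv_cexp.
Qed.

(* Both first-order factors w' - a w and w' - b w of the equation are
   exponentials; decay kills the one growing like exp(b t). *)
Lemma decaying_solution (a b : R[i]) (w w1 w2 : R -> R[i]) :
  complex.Re a < 0 -> 0 < complex.Re b ->
  derivatives_on_halfline w w1 w2 ->
  w t @[t --> +oo] --> (0 : R[i]^o) ->
  (forall t, 0 < t -> w2 t - (a + b) * w1 t + a * b * w t = 0) ->
  (forall t, 0 <= t -> w t = w 0 * cexp (a * t%:C%C)) /\ w1 0 = a * w 0.
Proof.
move=> a0 b0 [dw0 dw dw1] wlim eqw.
have ab : b - a != 0.
  rewrite subr_eq0; apply/eqP => ba.
  by move: b0; rewrite ba => /(lt_trans a0); rewrite ltxx.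
(* The operator factors as (D - y)(D - x) with the roots in either order; the two orders give two
   first-order relations, from which [w1] is eliminated. *)
have factor (x y : R[i]) : x + y = a + b -> x * y = a * b ->
    exists c, forall t, 0 < t -> w1 t - x * w t = c * cexp (y * t%:C%C).
  move=> xy1 xy2.
  apply: (@first_order_halfline _ _ (fun t => w2 t - x * w1 t)) => t t0.
    apply: cderivB; first exact/cvg_diff_quotP/dw1.
    by apply: cderivZ; exact/cvg_diff_quotP/dw.
  have := eqw t t0; rewrite -xy1 -xy2 => /eqP; rewrite -subr_eq0 subr0 => /eqP H.
  by apply/eqP; rewrite -subr_eq0; apply/eqP; rewrite -[RHS]H; ring.
have [c1 c1E] := factor a b erefl erefl.
have [c2 c2E] := factor b a (addrC _ _) (mulrC _ _).
have wE t : 0 < t ->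
    (b - a) * w t = c1 * cexp (b * t%:C%C) - c2 * cexp (a * t%:C%C).
  by move=> t0; rewrite -c1E// -c2E//; ring.
(* Both [w] and exp(a t) tend to 0, hence so does [c1] exp(b t). Multiplying by the decaying exp(- b
   t) leaves the constant [c1], with limit 0. *)
have c10 : c1 = 0.
  have lim0 : c1 * cexp (b * t%:C%C) @[t --> +oo] --> (0 : R[i]^o).
    have : (b - a) * w t - (- c2) * cexp (a * t%:C%C) @[t --> +oo]
        --> ((b - a) * 0 - (- c2) * 0 : R[i]^o).
      apply: cvg_complexB; first exact: cvg_complexZ.
      by apply: cvg_complexZ; exact: cvg_cexp_pinfty.
    rewrite !mulr0 subr0; apply: cvg_trans; apply: near_eq_cvg; near=> t.
    rewrite wE; last by near: t; exact: nbhs_pinfty_gt.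
    by ring.
  have limN : cexp (- b * t%:C%C) @[t --> +oo] --> (0 : R[i]^o).
    by apply: cvg_cexp_pinfty; rewrite cReN oppr_lt0.
  have lim0' : c1 * cexp (b * t%:C%C) * cexp (- b * t%:C%C) @[t --> +oo]
      --> (0 * 0 : R[i]^o).
    exact: cvg_complexM lim0 limN.
  rewrite mul0r in lim0'.
  apply: (cvg_complex_unique _ lim0').
  rewrite (_ : (fun s => _) = cst c1); first exact: (@cvg_cst R[i]^o).
  apply/funext => s.
  by rewrite -mulrA -cexpD mulNr addrN cexp0 mulr1.
pose c := - c2 / (b - a).
have wc t : 0 < t -> w t = c * cexp (a * t%:C%C).
  move=> /wE; rewrite c10 mul0r sub0r => H.
  by apply: (mulfI ab); rewrite H /c mulrA mulrCA divff// mulr1 mulNr.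
have [dc _ _] := derivatives_cexp a c.
have [w0c w10] := right_data_unique wc dw0 dc.
have {}w0c : w 0 = c by rewrite w0c mulr0 cexp0 mulr1.
split=> [t|].
  rewrite le_eqVlt => /predU1P[<-|/wc ->]; last by rewrite w0c.
  by rewrite mulr0 cexp0 mulr1.
by rewrite w10 w0c mulr0 cexp0 mulr1 mulrC.
Unshelve. all: by end_near.
Qed.

End HalflineODE.

(** * The boundary condition *)

Lemma det_mx22 (K : comNzRingType) (M : 'M[K]_2) :
  \det M = M 0 0 * M 1 1 - M 0 1 * M 1 0.
Proof.
rewrite (expand_det_row _ 0) !big_ord_recl big_ord0 addr0 /cofactor !det_mx11.
rewrite !mxE /= expr0 expr1 mul1r mulN1r mulrN.
by congr (_ * M _ _ - M _ _ * M _ _); exact: val_inj.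
Qed.

Section FrozenAlgebra.
Context {R : realType} {m : nat}.
Implicit Types (a : 'M[R[i]]_m.+1) (tau : 'rV[R]_m).

(** The characteristic polynomial of the second frozen equation: exp(i l t) is a solution exactly
    when [l] is a root. *)
Definition symbol a tau (l : R[i]) : R[i] :=
  coef_tt a tau + 2 * coef_tn a tau * l + coef_nn a * l ^+ 2.

Lemma sqnorm_gt0 tau : tau != 0 -> 0 < sqnorm tau.
Proof.
move=> tau0; rewrite lt_def sumr_ge0 ?andbT => [|j _]; last exact: sqr_ge0.
apply: contra tau0; rewrite psumr_eq0 => [/allP H|j _]; last exact: sqr_ge0.
apply/eqP/rowP => j; rewrite mxE.
by have := H j (mem_index_enum _); rewrite /= sqrf_eq0 => /eqP.
Qed.

Lemma det_Bmat a tau :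
  \det (Bmat a tau) = coef_tt a tau * coef_nn a - coef_tn a tau ^+ 2.
Proof.
rewrite (@det_mx22 _ (Bmat a tau)).
pose i0 : 'I_(1 + 1) := lshift 1 (0 : 'I_1).
pose i1 : 'I_(1 + 1) := rshift 1 (0 : 'I_1).
transitivity (Bmat a tau i0 i0 * Bmat a tau i1 i1 -
              Bmat a tau i0 i1 * Bmat a tau i1 i0).
  by congr (Bmat a tau _ _ * Bmat a tau _ _ - Bmat a tau _ _ * Bmat a tau _ _);
     exact: val_inj.
rewrite /Bmat block_mxEul block_mxEdr block_mxEur block_mxEdl !mxE eqxx.
by rewrite !mulr1n expr2.
Qed.

(** Subtracting the two equations and cancelling [l1 - l2] gives the sum of the roots; substitution
    gives the product. The factor [coef_nn a] stays multiplied in, since in dimension two these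
    relations serve to prove it nonzero. *)
Lemma symbol_vieta a tau (l1 l2 : R[i]) : l1 != l2 ->
  symbol a tau l1 = 0 -> symbol a tau l2 = 0 ->
  2 * coef_tn a tau = - (coef_nn a * (l1 + l2)) /\
  coef_tt a tau = coef_nn a * (l1 * l2).
Proof.
rewrite /symbol -subr_eq0; set p := coef_tt _ _; set q := coef_tn _ _.
set r := coef_nn _ => l12 e1 e2.
have tnE : 2 * q = - (r * (l1 + l2)).
  apply: (mulIf l12); apply/eqP; rewrite -subr_eq0; apply/eqP.
  by transitivity ((p + 2 * q * l1 + r * l1 ^+ 2) -
    (p + 2 * q * l2 + r * l2 ^+ 2)); [ring | rewrite e1 e2 subrr].
split=> //; apply/eqP; rewrite -subr_eq0; apply/eqP.
by rewrite -[RHS]e1 tnE; ring.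
Qed.

Lemma frozen_problem_unique a tau (l1 l2 : R[i]) :
  coef_nn a != 0 -> tau != 0 -> 0 < complex.Im l1 -> complex.Im l2 < 0 ->
  symbol a tau l1 = 0 -> symbol a tau l2 = 0 ->
  (forall u v, frozen_solution a tau u v ->
     forall t : R, 0 <= t -> u t = 0 /\ v t = 0) <->
  coef_tn a tau + coef_nn a * l1 <> 'i%C * (Num.sqrt (sqnorm tau))%:C%C.
Proof.
move=> nn0 tau0 Il1 Il2 e1 e2.
have l12 : l1 != l2.
  by apply/eqP => l12; move: Il2; rewrite -l12 => /(lt_trans Il1); rewrite ltxx.
have [tnE ttE] := symbol_vieta l12 e1 e2.
have sq0 := sqnorm_gt0 tau0.
set s := Num.sqrt _.
have s0 : 0 < s by rewrite sqrtr_gt0.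
have sE : sqnorm tau = s ^+ 2 by rewrite sqr_sqrtr// ltW.
have ii : 'i%C * 'i%C = -1 :> R[i] by rewrite -expr2 sqr_i.
have Re_il (l : R[i]) : complex.Re ('i%C * l) = - complex.Im l.
  by rewrite mulrC ReiNIm.
(* By the relations between roots and coefficients, the second frozen operator is [coef_nn a] times
   (D - i l1)(D - i l2), the form required by [decaying_solution]. *)
have vE (x0 x1 x2 : R[i]) :
    coef_nn a * (x2 - ('i%C * l1 + 'i%C * l2) * x1 +
      'i%C * l1 * ('i%C * l2) * x0) =
    coef_nn a * x2 + 2 * 'i%C * coef_tn a tau * x1 - coef_tt a tau * x0.
  rewrite (_ : 2 * _ * _ = 'i%C * (2 * coef_tn a tau)); last by ring.
  rewrite tnE ttE (_ : 'i%C * l1 * ('i%C * l2) = 'i%C * 'i%C * (l1 * l2));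
    last by ring.
  by rewrite ii; ring.
split=> [uniq eq_is|neq_is u v [u1 [u2 [v1 [v2 [du dv [u_lim v_lim] eqs]]]]] [bc0 bc1]].
  (* In the excluded case the two decaying exponentials with value 1 at 0 satisfy both boundary
     conditions. *)
  have sol : frozen_solution a tau
      (fun t => 1 * cexp ((- s)%:C%C * t%:C%C))
      (fun t => 1 * cexp ('i%C * l1 * t%:C%C)).
    do 4 eexists; split.
    - exact: derivatives_cexp.
    - exact: derivatives_cexp.
    - split; rewrite -[X in _ --> X](mulr0 1); apply: cvg_complexZ;
        apply: cvg_cexp_pinfty; first by rewrite /= oppr_lt0.
      by rewrite Re_il oppr_lt0.
    - move=> t _; split; last by rewrite -vE; ring.
      by rewrite sE rmorphN rmorphXn /=; ring.
    - rewrite !mulr0 cexp0 !mulr1 !mul1r subrr; split=> //.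
      rewrite rmorphN /= mulrCA -mulrDr eq_is mulrA ii; ring.
  have [] := uniq _ _ sol 0 (lexx _).
  by rewrite mulr0 cexp0 mulr1 => /eqP; rewrite oner_eq0.
have [uE u10] : (forall t, 0 <= t -> u t = u 0 * cexp ((- s)%:C%C * t%:C%C)) /\
    u1 0 = (- s)%:C%C * u 0.
  apply: (@decaying_solution _ _ s%:C%C _ _ u2) => //=; first by rewrite oppr_lt0.
  move=> t /eqs[+ _]; rewrite sE => <-.
  by rewrite rmorphN rmorphXn /=; ring.
have [vE' v10] : (forall t, 0 <= t -> v t = v 0 * cexp ('i%C * l1 * t%:C%C)) /\
    v1 0 = 'i%C * l1 * v 0.
  apply: (@decaying_solution _ _ ('i%C * l2) _ _ v2) => //=.
  - by rewrite Re_il oppr_lt0.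
  - by rewrite Re_il oppr_gt0.
  - move=> t /eqs[_ e]; apply: (mulfI nn0).
    by rewrite mulr0 vE.
have uv : u 0 = v 0 by apply/eqP; rewrite -subr_eq0; apply/eqP.
(* Substituting the derivatives at 0 into the second boundary condition leaves a scalar times [v 0];
   the scalar vanishes only in the excluded case. *)
have v0 : v 0 = 0.
  move: bc1; rewrite u10 v10 uv => H.
  have /eqP : (s%:C%C + 'i%C * (coef_tn a tau + coef_nn a * l1)) * v 0 = 0.
    by rewrite -[RHS]oppr0 -H rmorphN /=; ring.
  rewrite mulf_eq0 => /orP[|/eqP//]; rewrite addr_eq0 => /eqP sE'.
  case: neq_is; rewrite sE' mulrN mulrA ii; ring.
by move=> t t0; rewrite uE// vE'// uv v0 !mul0r.
Qed.

(** For nonzero [d], z = i x conj(d) / |d|^2, whose real part is x Im d / |d|^2; the denominator is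
    cleared. *)
Lemma Re_sign_of_mul_imaginary (z d : R[i]) (x : R) :
  z * d = 'i%C * x%:C%C ->
  complex.Re z * (complex.Re d ^+ 2 + complex.Im d ^+ 2) = x * complex.Im d.
Proof.
case: z d => [p q] [e f] H.
have /= [H1 H2] : complex.Re (Complex p q * Complex e f) = 0 /\
    complex.Im (Complex p q * Complex e f) = x.
  by rewrite H /=; split; ring.
rewrite /= -H2 mulrDl -[LHS]subr0 -[X in _ - X](mul0r e) -H1; ring.
Qed.

Lemma unstable_root_criterion a tau (l1 l2 : R[i]) :
  tau != 0 -> 0 < complex.Im l1 -> complex.Im l2 < 0 ->
  symbol a tau l1 = 0 -> symbol a tau l2 = 0 ->
  coef_tn a tau + coef_nn a * l1 <> 'i%C * (Num.sqrt (sqnorm tau))%:C%C <->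
  \det (Bmat a tau) <> (sqnorm tau)%:C%C \/ complex.Re (coef_nn a) < 0.
Proof.
move=> tau0 Il1 Il2 e1 e2.
have l12 : l1 != l2.
  by apply/eqP => l12; move: Il2; rewrite -l12 => /(lt_trans Il1); rewrite ltxx.
have [tnE ttE] := symbol_vieta l12 e1 e2.
have sq0 := sqnorm_gt0 tau0.
set s := Num.sqrt _.
have s0 : 0 < s by rewrite sqrtr_gt0.
have sE : sqnorm tau = s ^+ 2 by rewrite sqr_sqrtr// ltW.
have Id : 0 < complex.Im (l1 - l2) by rewrite cImD cImN subr_gt0 (lt_trans Il2).
have nd : 0 < complex.Re (l1 - l2) ^+ 2 + complex.Im (l1 - l2) ^+ 2.
  by rewrite ltr_wpDl ?sqr_ge0// exprn_gt0.
have dE : coef_nn a * (l1 - l2) = 2 * (coef_tn a tau + coef_nn a * l1).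
  by rewrite [RHS]mulrDr tnE; ring.
have detE : \det (Bmat a tau) = - (coef_tn a tau + coef_nn a * l1) ^+ 2.
  rewrite det_Bmat -[RHS]addr0 -(mulr0 (coef_nn a)) -e1 /symbol; ring.
have isE : ('i%C * s%:C%C) ^+ 2 = - (s ^+ 2)%:C%C :> R[i].
  by rewrite exprMn sqr_i mulN1r rmorphXn.
rewrite detE sE; split=> [neq|[neq eq_is|Re_lt0 eq_is]].
(* If the determinant equals s^2, then [coef_tn a tau + coef_nn a * l1] is i s or - i s. The first
   is excluded, and the second makes [complex.Re (coef_nn a)] negative. *)
- have [detB|/eqP ?] :=
    eqVneq (- (coef_tn a tau + coef_nn a * l1) ^+ 2) (s ^+ 2)%:C%C;
    last by left.
  right; move: detB => /(congr1 -%R); rewrite opprK -isE => /eqP.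
  rewrite eqf_sqr => /orP[/eqP/neq //|/eqP eqN].
  have := @Re_sign_of_mul_imaginary (coef_nn a) (l1 - l2) (- (2 * s)).
  rewrite dE eqN rmorphN rmorphM /= => /(_ ltac:(ring)) H.
  by rewrite -(pmulr_llt0 _ nd) H mulNr oppr_lt0 !mulr_gt0.
- by apply: neq; rewrite eq_is isE opprK.
- have := @Re_sign_of_mul_imaginary (coef_nn a) (l1 - l2) (2 * s).
  rewrite dE eq_is rmorphM /= => /(_ ltac:(ring)) H.
  by move: Re_lt0; rewrite -(pmulr_llt0 _ nd) H ltNge !mulr_ge0// ltW.
Qed.

End FrozenAlgebra.

(** * Location of quadratic roots *)

Section QuadraticRoots.
Context {R : realType}.
Implicit Types (b c z s : R[i]) (t x : R).

(** The modulus as an element of [R]; the norm on [R[i]] takes its values in [R[i]]. *)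
Definition cmod z : R := Num.sqrt (complex.Re z ^+ 2 + complex.Im z ^+ 2).

(** For s = x + i y, the modulus of s^2 is x^2 + y^2 and its real part is x^2 - y^2. *)
Lemma complex_sqrt_Im z :
  exists2 s, s ^+ 2 = z & 2 * complex.Im s ^+ 2 = cmod z - complex.Re z.
Proof.
exists (sqrtC z); first exact: sqrtCK.
rewrite -[in RHS](sqrtCK z) /cmod; case: (sqrtC z) => x y.
rewrite expr2 !complex_partsE /=.
rewrite (_ : _ ^+ 2 + _ ^+ 2 = (x ^+ 2 + y ^+ 2) ^+ 2); last by ring.
by rewrite sqrtr_sqr ger0_norm ?addr_ge0 ?sqr_ge0//; ring.
Qed.

(* Twice the product of the imaginary parts of the two roots
   of l^2 + 2 b l + c. *)
Definition root_sign b c : R :=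
  2 * complex.Im b ^+ 2 + complex.Re (b ^+ 2 - c) - cmod (b ^+ 2 - c).

(** The roots are - b + s and - b - s with s^2 = b^2 - c, so their imaginary parts have product (Im
    b)^2 - (Im s)^2. The sign of Im s decides which one is [l1]. *)
Lemma quadratic_roots b c : exists l1 l2,
  [/\ l1 ^+ 2 + 2 * b * l1 + c = 0, l2 ^+ 2 + 2 * b * l2 + c = 0,
      complex.Im l2 <= complex.Im l1 &
      root_sign b c = 2 * (complex.Im l1 * complex.Im l2)].
Proof.
have [s sE Is] := complex_sqrt_Im (b ^+ 2 - c).
have root s' : s' ^+ 2 = b ^+ 2 - c ->
    (- b + s') ^+ 2 + 2 * b * (- b + s') + c = 0.
  by move=> s'E; rewrite sqrrD s'E; ring.
have sE' : (- s) ^+ 2 = b ^+ 2 - c by rewrite sqrrN.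
have sgn : root_sign b c =
    2 * (complex.Im (- b + s) * complex.Im (- b + - s)).
  rewrite /root_sign -addrA -opprB -Is !complex_partsE; ring.
have [s0|s0] := leP 0 (complex.Im s).
- exists (- b + s), (- b + - s); split; rewrite ?root//.
  by rewrite !complex_partsE; lra.
- exists (- b + - s), (- b + s); split; rewrite ?root//.
    by rewrite !complex_partsE; lra.
  by rewrite sgn; ring.
Qed.

Lemma root_sign_neq0 b c :
  (forall x, x%:C%C ^+ 2 + 2 * b * x%:C%C + c != 0) -> root_sign b c != 0.
Proof.
have real l : complex.Im l = 0 -> l = (complex.Re l)%:C%C.
  by case: l => p q /= ->.
have [l1 [l2 [e1 e2 _ ->]]] := quadratic_roots b c => nreal.
rewrite !mulf_neq0 ?pnatr_eq0//; apply/eqP => /real E.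
- by have := nreal (complex.Re l1); rewrite -E e1 eqxx.
- by have := nreal (complex.Re l2); rewrite -E e2 eqxx.
Qed.

(** When [b] is real the roots have opposite imaginary parts; in the closed form this is Re z <=
    |z|. *)
Lemma root_sign_le0 b c : complex.Im b = 0 -> root_sign b c <= 0.
Proof.
rewrite /root_sign => ->; rewrite expr0n /= mulr0 add0r subr_le0 /cmod.
apply: le_trans (ler_norm _) _.
by rewrite -sqrtr_sqr ler_sqrt ?addr_ge0 ?sqr_ge0// lerDl sqr_ge0.
Qed.

Lemma continuous_quadratic (d0 d1 d2 : R) :
  continuous (fun t => d0 + t * d1 + t ^+ 2 * d2).
Proof.
move=> t; apply: cvgD; last by apply: cvgM; [exact: exprn_continuous|exact: cvg_cst].
by apply: cvgD; [exact: cvg_cst|apply: cvgM; [exact: cvg_id|exact: cvg_cst]].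
Qed.

(** The closed form of [root_sign] takes the square root of a nonnegative real only, so no branch of
    the complex root has to be followed along the path. *)
Lemma continuous_root_sign (b0 b1 c0 c1 c2 : R[i]) :
  continuous (fun t => root_sign (b0 + t%:C%C * b1)
                         (c0 + t%:C%C * c1 + t%:C%C ^+ 2 * c2)).
Proof.
pose D0 := b0 ^+ 2 - c0; pose D1 := 2 * (b0 * b1) - c1.
pose D2 := b1 ^+ 2 - c2.
pose rD t := complex.Re D0 + t * complex.Re D1 + t ^+ 2 * complex.Re D2.
pose iD t := complex.Im D0 + t * complex.Im D1 + t ^+ 2 * complex.Im D2.
(* The zero quadratic term gives [iB] the shape of [continuous_quadratic]. *)
pose iB t := complex.Im b0 + t * complex.Im b1 + t ^+ 2 * 0.
rewrite (_ : (fun t => _) = fun t =>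
    2 * (iB t * iB t) + rD t - Num.sqrt (rD t * rD t + iD t * iD t)).
  have crD : continuous rD by exact: continuous_quadratic.
  have ciD : continuous iD by exact: continuous_quadratic.
  have ciB : continuous iB by exact: continuous_quadratic.
  move=> t; apply: cvgB.
    apply: cvgD; last exact: crD.
    by apply: cvgM; [exact: cvg_cst|apply: cvgM; exact: ciB].
  apply: (@continuous_comp _ _ _ (fun t => rD t * rD t + iD t * iD t) Num.sqrt).
    by apply: cvgD; apply: cvgM; first [exact: crD|exact: ciD].
  exact: sqrt_continuous.
apply/funext => t; rewrite /root_sign /cmod.
have -> : (b0 + t%:C%C * b1) ^+ 2 - (c0 + t%:C%C * c1 + t%:C%C ^+ 2 * c2) =
    D0 + t%:C%C * D1 + t%:C%C ^+ 2 * D2 by rewrite /D0 /D1 /D2; ring.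
have Re_t d0 d1 d2 : complex.Re (d0 + t%:C%C * d1 + t%:C%C ^+ 2 * d2) =
    complex.Re d0 + t * complex.Re d1 + t ^+ 2 * complex.Re d2.
  by rewrite -rmorphXn !complex_partsE /=; ring.
have Im_t d0 d1 d2 : complex.Im (d0 + t%:C%C * d1 + t%:C%C ^+ 2 * d2) =
    complex.Im d0 + t * complex.Im d1 + t ^+ 2 * complex.Im d2.
  by rewrite -rmorphXn !complex_partsE /=; ring.
rewrite Re_t Im_t cImD cImM /= mul0r addr0 -!expr2.
by rewrite /iB mulr0 addr0.
Qed.

(* No root crosses the real axis along the path, and at t = 1 the imaginary
   parts of the two roots add up to zero. *)
Lemma opposite_roots_of_path (b0 b1 c0 c1 c2 : R[i]) :
  (forall t x, 0 <= t <= 1 -> x%:C%C ^+ 2 + 2 * (b0 + t%:C%C * b1) * x%:C%C +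
    (c0 + t%:C%C * c1 + t%:C%C ^+ 2 * c2) != 0) ->
  complex.Im (b0 + b1) = 0 ->
  exists l1 l2, [/\ 0 < complex.Im l1, complex.Im l2 < 0,
    l1 ^+ 2 + 2 * b0 * l1 + c0 = 0 & l2 ^+ 2 + 2 * b0 * l2 + c0 = 0].
Proof.
move=> nreal Ib.
pose h t := root_sign (b0 + t%:C%C * b1) (c0 + t%:C%C * c1 + t%:C%C ^+ 2 * c2).
have h_neq0 t : 0 <= t <= 1 -> h t != 0.
  by move=> t01; apply: root_sign_neq0 => x; exact: nreal.
have h1 : h 1 < 0.
  rewrite lt_neqAle h_neq0 ?ler01 ?lexx//=.
  by apply: root_sign_le0; rewrite mul1r.
have h0 : h 0 < 0.
  (* Otherwise the intermediate value theorem yields a zero of [h] on [0, 1], against [h_neq0]. *)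
  rewrite ltNge; apply/negP => h0.
  have [|||t] := @IVT _ h 0 1 0.
  - exact: ler01.
  - by apply: continuous_subspaceT; exact: continuous_root_sign.
  - by rewrite ge_min (ltW h1) orbT le_max h0.
  - by rewrite in_itv /= => /h_neq0/eqP.
have [l1 [l2 [e1 e2 l21 sgn]]] := quadratic_roots b0 c0.
exists l1, l2.
have : complex.Im l1 * complex.Im l2 < 0.
  by move: h0; rewrite /h mul0r addr0 expr0n /= !mul0r !addr0 sgn pmulr_rlt0.
have [p|p|->] := ltrgt0P (complex.Im l1).
- by rewrite pmulr_rlt0.
- by rewrite ltNge mulr_le0// ?ltW// (le_lt_trans l21).
- by rewrite mul0r ltxx.
Qed.

End QuadraticRoots.

(** * Local coefficients *)

Section LocalCoefficients.
Context {R : realType} {m : nat}.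
Implicit Types (A a : 'M[R[i]]_m.+1) (E : 'M[R]_m.+1) (tau : 'rV[R]_m).

Definition extend (K : Type) (v : 'rV[K]_m) (x : K) : 'rV[K]_m.+1 :=
  \row_i (if unlift ord_max i is Some j then v 0 j else x).

Lemma extend_lift (K : Type) (v : 'rV[K]_m) x j :
  extend v x 0 (lift ord_max j) = v 0 j.
Proof. by rewrite mxE liftK. Qed.

Lemma extend_max (K : Type) (v : 'rV[K]_m) x : extend v x 0 ord_max = x.
Proof. by rewrite mxE unlift_none. Qed.

Lemma extendE (K : pzRingType) (v : 'rV[K]_m) x :
  extend v x = extend v 0 + x *: delta_mx 0 ord_max.
Proof.
apply/rowP => i; rewrite !mxE eqxx /=.
case: unliftP => [j ->|->]; last by rewrite eqxx mulr1 add0r.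
by rewrite eq_sym (negbTE (neq_lift _ _)) mulr0 addr0.
Qed.

Lemma cplx_extend tau (x : R) : cplx (extend tau x) = extend (cplx tau) x%:C%C.
Proof. by apply/rowP => i; rewrite !mxE; case: unlift => [j|]; rewrite ?mxE. Qed.

(** The entry (i, j) of [local_coef A E] is the entry (j, i) of the congruence on the right;
    symmetry of [A] removes the transposition. *)
Lemma local_coef_mulmx A E : A^T = A ->
  local_coef A E =
  map_mx (real_complex R) E *m A *m (map_mx (real_complex R) E)^T.
Proof.
move=> symA; set Ec := map_mx _ E.
have <- : (Ec *m A *m Ec^T)^T = Ec *m A *m Ec^T.
  by rewrite !trmx_mul trmxK symA mulmxA.
apply/matrixP => i j; rewrite mxE /bilin /cplx !map_row -row_mul.
by rewrite tr_row !mxE; apply: eq_bigr => k _; rewrite !mxE.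
Qed.

Lemma local_coef_sym A E : A^T = A -> (local_coef A E)^T = local_coef A E.
Proof.
by move=> symA; rewrite local_coef_mulmx// !trmx_mul trmxK symA mulmxA.
Qed.

Lemma det_local_coef A E : A^T = A -> E *m E^T = 1%:M ->
  \det (local_coef A E) = \det A.
Proof.
move=> symA EE; rewrite local_coef_mulmx// !det_mulmx mulrAC -det_mulmx.
by rewrite map_trmx -map_mxM EE map_mx1 det1 mul1r.
Qed.

Lemma quadratic_form_extend (K : comNzRingType) (a : 'M[K]_m.+1)
    (v : 'rV[K]_m) (l : K) : a^T = a ->
  (extend v l *m a *m (extend v l)^T) 0 0 =
  \sum_(i < m) \sum_(j < m) a (lift ord_max i) (lift ord_max j) * v 0 i * v 0 j +
  2 * (\sum_(j < m) a (lift ord_max j) ord_max * v 0 j) * l +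
  a ord_max ord_max * l ^+ 2.
Proof.
move=> symA; have mulE j : (extend v l *m a) 0 j =
    l * a ord_max j + \sum_(i < m) v 0 i * a (lift ord_max i) j.
  rewrite mxE (bigD1_ord ord_max)//= extend_max; congr (_ + _).
  by apply: eq_bigr => i _; rewrite extend_lift.
rewrite mxE (bigD1_ord ord_max)//= mulE [_^T _ _]mxE extend_max.
rewrite [X in _ + X = _](eq_bigr (fun j => l * (a (lift ord_max j) ord_max * v 0 j) +
  \sum_(i < m) a (lift ord_max i) (lift ord_max j) * v 0 i * v 0 j)); last first.
  move=> j _; rewrite mulE [_^T _ _]mxE extend_lift mulrDl -{1}symA mxE mulrA.
  congr (_ + _); rewrite mulr_suml; apply: eq_bigr => i _.
  by rewrite (mulrC (v 0 i)).
rewrite big_split /= -mulr_sumr exchange_big /=.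
rewrite (eq_bigr (fun j => a (lift ord_max j) ord_max * v 0 j)).
  by ring.
by move=> j _; rewrite mulrC.
Qed.

Lemma bilin_extend a tau (l : R[i]) : a^T = a ->
  bilin a (extend (cplx tau) l) (extend (cplx tau) l) = symbol a tau l.
Proof.
move=> symA; apply: etrans; first exact: quadratic_form_extend.
congr (_ + 2 * _ * _ + _).
  by apply: eq_bigr => i _; apply: eq_bigr => j _; rewrite !mxE.
by apply: eq_bigr => i _; rewrite !mxE.
Qed.

(** Transfers ellipticity of [A], stated in the original coordinates, to the symbol in the adapted
    basis. *)
Lemma bilin_extend_local A E tau (l : R[i]) : A^T = A ->
  let s := extend (cplx tau) l *m map_mx (real_complex R) E in
  bilin A s s = symbol (local_coef A E) tau l.
Proof.
move=> symA /=; rewrite -bilin_extend ?local_coef_sym// local_coef_mulmx//.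
by rewrite /bilin trmx_mul !mulmxA.
Qed.

Lemma coef_tnD a tau (sigma : 'rV[R]_m) (t : R) :
  coef_tn a (tau + t *: sigma) = coef_tn a tau + t%:C%C * coef_tn a sigma.
Proof.
rewrite /coef_tn mulr_sumr -big_split /=; apply: eq_bigr => j _.
by rewrite !mxE rmorphD rmorphM /=; ring.
Qed.

(** The cross term [X] stays abstract: what the path argument uses is that it does not depend on
    [t]. *)
Lemma coef_ttD a tau (sigma : 'rV[R]_m) : exists X, forall t : R,
  coef_tt a (tau + t *: sigma) =
  coef_tt a tau + t%:C%C * X + t%:C%C ^+ 2 * coef_tt a sigma.
Proof.
exists (\sum_(i < m) \sum_(j < m) a (lift ord_max i) (lift ord_max j) *
  ((tau 0 i)%:C%C * (sigma 0 j)%:C%C + (sigma 0 i)%:C%C * (tau 0 j)%:C%C)) => t.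
rewrite /coef_tt !mulr_sumr -!big_split /=; apply: eq_bigr => i _.
rewrite !mulr_sumr -!big_split /=; apply: eq_bigr => j _.
by rewrite !mxE !rmorphD !rmorphM /=; ring.
Qed.

Lemma coef_tnZ a tau (t : R) : coef_tn a (t *: tau) = t%:C%C * coef_tn a tau.
Proof.
rewrite /coef_tn mulr_sumr; apply: eq_bigr => j _.
by rewrite !mxE rmorphM /=; ring.
Qed.

Lemma coef_ttZ a tau (t : R) :
  coef_tt a (t *: tau) = t%:C%C ^+ 2 * coef_tt a tau.
Proof.
rewrite /coef_tt mulr_sumr; apply: eq_bigr => i _.
rewrite mulr_sumr; apply: eq_bigr => j _.
by rewrite !mxE !rmorphM /=; ring.
Qed.

Lemma det_BmatZ a tau (t : R) :
  \det (Bmat a (t *: tau)) = t%:C%C ^+ 2 * \det (Bmat a tau).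
Proof. by rewrite !det_Bmat coef_tnZ coef_ttZ; ring. Qed.

Lemma sqnormZ tau (t : R) : sqnorm (t *: tau) = t ^+ 2 * sqnorm tau.
Proof.
by rewrite /sqnorm mulr_sumr; apply: eq_bigr => j _; rewrite mxE exprMn.
Qed.

(* The form of ellipticity that serves both dimensions: in dimension 2 it is
   part of the definition, in dimension 3 it is a consequence. *)
Definition properly_elliptic a : Prop :=
  coef_nn a != 0 /\
  forall tau, tau != 0 -> exists l1 l2 : R[i],
    [/\ 0 < complex.Im l1, complex.Im l2 < 0,
        symbol a tau l1 = 0 & symbol a tau l2 = 0].

Lemma frozen_problem_criterion a : properly_elliptic a ->
  (forall tau, tau != 0 -> forall u v, frozen_solution a tau u v ->
     forall t : R, 0 <= t -> u t = 0 /\ v t = 0) <->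
  (forall tau, tau != 0 ->
     \det (Bmat a tau) <> (sqnorm tau)%:C%C \/ complex.Re (coef_nn a) < 0).
Proof.
move=> [nn0 roots]; split=> H tau tau0;
  have [l1 [l2 [Il1 Il2 e1 e2]]] := roots tau tau0;
  have crit := unstable_root_criterion tau0 Il1 Il2 e1 e2;
  have uniq := frozen_problem_unique nn0 tau0 Il1 Il2 e1 e2.
- by apply/crit/uniq; exact: H.
- by apply/uniq/crit; exact: H.
Qed.

(** [\det (Bmat a tau)] and [sqnorm tau] are both homogeneous of degree two in [tau], so normalizing
    [tau] suffices; the sign condition does not involve [tau] and leaves the quantifier. *)
Lemma unit_covector_criterion a :
  (forall tau, tau != 0 ->
     \det (Bmat a tau) <> (sqnorm tau)%:C%C \/ complex.Re (coef_nn a) < 0) <->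
  ((forall tau, sqnorm tau = 1 -> \det (Bmat a tau) <> 1) \/
   complex.Re (coef_nn a) < 0).
Proof.
have [Re_lt0|Re_ge0] := ltP (complex.Re (coef_nn a)) 0.
  by split=> _; [right|move=> tau _; right].
split=> [H|[H|//] tau tau0].
  left=> tau tau1; have tau0 : tau != 0.
    apply/eqP => tau0; move: tau1; rewrite tau0 -(scale0r 0) sqnormZ.
    by rewrite expr0n mul0r => /eqP; rewrite eq_sym oner_eq0.
  by have [|//] := H tau tau0; rewrite tau1.
left=> detB; have sq0 := sqnorm_gt0 tau0.
have sE := sqr_sqrtr (ltW sq0).
have s0 : Num.sqrt (sqnorm tau) != 0 by rewrite sqrtr_eq0 -ltNge.
apply: (H ((Num.sqrt (sqnorm tau))^-1 *: tau)).
  by rewrite sqnormZ exprVn sE mulVf// gt_eqF.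
by rewrite det_BmatZ detB -rmorphXn -rmorphM /= exprVn sE mulVf// gt_eqF.
Qed.

Lemma properly_elliptic2 A E : m.+1 = 2%N -> A^T = A -> E *m E^T = 1%:M ->
  elliptic A -> properly_elliptic (local_coef A E).
Proof.
move=> m2 symA EE [_ /(_ m2) ell]; set a := local_coef A E.
have Eu : E \in unitmx by have [] := mulmx1_unit EE.
have roots tau : tau != 0 ->
    (exists! l : R[i], 0 < complex.Im l /\ symbol a tau l = 0) /\
    (exists! l : R[i], complex.Im l < 0 /\ symbol a tau l = 0).
  move=> tau0; pose xi1 := extend tau 0 *m E; pose xi2 := row ord_max E.
  have free12 : row_free (col_mx xi1 xi2).
    (* Cancelling the invertible [E] from a vanishing combination leaves [x] times [tau] in the
       tangential entries, so [x] is 0, and then [y] in the normal entry. *)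
    apply: inj_row_free => v; rewrite -[v]hsubmxK mul_row_col.
    rewrite (mx11_scalar (lsubmx v)) (mx11_scalar (rsubmx v)).
    set x := lsubmx v 0 0; set y := rsubmx v 0 0.
    rewrite !mul_scalar_mx /xi2 rowE /xi1 !scalemxAl -mulmxDl => /eqP.
    rewrite -(mul0mx _ E) => /eqP/(can_inj (mulmxK Eu))/rowP v0.
    have /eqP x0 : x == 0.
      apply: contraNT tau0 => x0; apply/eqP/rowP => j.
      have := v0 (lift ord_max j).
      rewrite !mxE liftK eqxx /=.
      rewrite eq_sym (negbTE (neq_lift _ _)) mulr0 addr0 => /eqP.
      by rewrite mulf_eq0 (negbTE x0) => /eqP.
    have y0 : y = 0.
      have := v0 ord_max.
      by rewrite x0 scale0r add0r !mxE !eqxx mulr1.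
    by rewrite x0 y0 !raddf0 row_mx0.
  have qE l : bilin A (cplx xi1 + l *: cplx xi2) (cplx xi1 + l *: cplx xi2) =
      symbol a tau l.
    rewrite -bilin_extend_local// extendE /xi1 /xi2 rowE /cplx !map_mxM.
    rewrite -/(cplx (extend tau 0)) cplx_extend mulmxDl scalemxAl.
    by rewrite map_delta_mx.
  have /= [[l1 [[Il1 e1] u1]] [l2 [[Il2 e2] u2]]] := ell xi1 xi2 free12.
  split; [exists l1|exists l2]; split; rewrite -?qE// => l [Il e];
    [apply: u1|apply: u2]; by rewrite qE.
split; last first.
  move=> tau /roots[[l1 [[Il1 e1] _]] [l2 [[Il2 e2] _]]].
  by exists l1, l2.
have tau0 : (const_mx 1 : 'rV[R]_m) != 0.
  have m0 : (0 < m)%N by rewrite -ltnS m2.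
  by apply/eqP => /rowP/(_ (Ordinal m0))/eqP; rewrite !mxE oner_eq0.
have [[l1 [[Il1 e1] uniq1]] [l2 [[Il2 e2] _]]] := roots _ tau0.
have l12 : l1 != l2.
  by apply/eqP => l12; move: Il2; rewrite -l12 => /(lt_trans Il1); rewrite ltxx.
have [tnE ttE] := symbol_vieta l12 e1 e2.
(* If [coef_nn a] vanished, so would all coefficients of the symbol, and i and 2 i would be two
   distinct roots in the upper half-plane. *)
apply/eqP => nn0.
have zero l : symbol a (const_mx 1) l = 0.
  by rewrite /symbol tnE ttE nn0 !mul0r oppr0 mul0r !addr0.
have u1 := uniq1 'i%C (conj ltr01 (zero _)).
have u2 := uniq1 (Complex 0 2) (conj (ltr0Sn R 1) (zero _)).
by move: u2; rewrite u1 => /(congr1 (@complex.Im R)) /=; lra.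
Qed.

Lemma properly_elliptic3 A E : m.+1 = 3%N -> A^T = A -> E *m E^T = 1%:M ->
  elliptic A -> properly_elliptic (local_coef A E).
Proof.
move=> m3 symA EE [ell _]; set a := local_coef A E.
have Eu : E \in unitmx by have [] := mulmx1_unit EE.
have nz tau (x : R) : extend tau x != 0 -> symbol a tau x%:C%C != 0.
  move=> e0; rewrite -bilin_extend_local// -cplx_extend /cplx -map_mxM.
  apply: ell; first by rewrite m3.
  by apply: contra e0 => /eqP e0; rewrite -(mulmxK Eu (extend _ _)) e0 mul0mx.
(* The normal covector itself: tangential part 0 and normal component 1. *)
have nn0 : coef_nn a != 0.
  have := @nz 0 1; rewrite /symbol -(scale0r 0) coef_ttZ coef_tnZ.
  rewrite expr0n !(mul0r, mulr0) !add0r expr1n mulr1; apply.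
  by apply/eqP => /rowP/(_ ord_max)/eqP; rewrite extend_max mxE oner_eq0.
split=> // tau tau0.
(* [f] is real linear, and [f sigma] is the imaginary part of the coefficient b of the normalized
   quadratic l^2 + 2 b l + c at [sigma]; the path must end at a zero of [f]. *)
pose f sigma := complex.Im (coef_tn a sigma / coef_nn a).
have fD sigma rho (t : R) : f (sigma + t *: rho) = f sigma + t * f rho.
  rewrite /f coef_tnD mulrDl cImD; congr (_ + _).
  by rewrite -mulrA [LHS]cImM /= mul0r addr0.
have [sigma [fs path]] : exists sigma, f (tau + sigma) = 0 /\
    forall t : R, 0 <= t <= 1 -> tau + t *: sigma != 0.
  have [ft0|ft0] := eqVneq (f tau) 0.
    by exists 0; rewrite addr0; split=> // t _; rewrite scaler0 addr0.
  have m0 : (0 < m)%N by rewrite -ltnS m3.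
  have m1 : (1 < m)%N by rewrite -ltnS m3.
  (* The tangential plane is two-dimensional, so the real linear form f has a
     nonzero null vector rho; the segment from tau to rho avoids the origin
     because f vanishes on it only at rho. *)
  have [rho rho0 frho] : exists2 rho, rho != 0 & f rho = 0.
    pose e0 : 'rV[R]_m := delta_mx 0 (Ordinal m0).
    pose e1 : 'rV[R]_m := delta_mx 0 (Ordinal m1).
    have [fe0|fe0] := eqVneq (f e0) 0.
      exists e0 => //; apply/eqP => /rowP/(_ (Ordinal m0))/eqP.
      by rewrite !mxE !eqxx oner_eq0.
    exists (e1 + - (f e1 / f e0) *: e0); last by rewrite fD; field.
    apply/eqP => /rowP/(_ (Ordinal m1))/eqP.
    by rewrite !mxE !eqxx /= mulr0 addr0 oner_eq0.
  have fs : f (rho - tau) = - f tau by rewrite -scaleN1r fD frho add0r mulN1r.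
  exists (rho - tau); split=> [|t _]; first by rewrite addrC subrK.
  have f0 : f 0 = 0 by have := fD 0 0 1; rewrite scaler0 addr0; lra.
  apply/eqP => path0; have : (1 - t) * f tau = 0.
    by rewrite -[RHS]f0 -path0 fD fs; ring.
  move/eqP; rewrite mulf_eq0 (negbTE ft0) orbF subr_eq0 => /eqP t1.
  by move: path0; rewrite -t1 scale1r addrC subrK => /eqP; rewrite (negbTE rho0).
have [X ttE] := coef_ttD a tau sigma.
have symE sigma' l : symbol a sigma' l = coef_nn a *
    (l ^+ 2 + 2 * (coef_tn a sigma' / coef_nn a) * l + coef_tt a sigma' / coef_nn a).
  by rewrite /symbol; field.
have [||l1 [l2 [Il1 Il2 e1 e2]]] := @opposite_roots_of_path R
  (coef_tn a tau / coef_nn a) (coef_tn a sigma / coef_nn a)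
  (coef_tt a tau / coef_nn a) (X / coef_nn a) (coef_tt a sigma / coef_nn a).
- move=> t x /path path0.
  have : extend (tau + t *: sigma) x != 0.
    apply: contra path0 => /eqP/rowP e0; apply/eqP/rowP => j.
    by have := e0 (lift ord_max j); rewrite extend_lift !mxE.
  move/nz; rewrite symE mulf_eq0 (negbTE nn0) /= ttE coef_tnD.
  by congr (_ != 0); field.
- by rewrite -mulrDl -[coef_tn a sigma]mul1r -coef_tnD scale1r.
- by exists l1, l2; split; rewrite // symE (e1, e2) mulr0.
Qed.

End LocalCoefficients.

(** * The planar determinant and the pointwise equivalence *)

(** The single entry of [tau] is 1 or -1, so B agrees with [a] up to a common sign of the
    off-diagonal entries, which their product does not see. *)
Lemma det_Bmat_planar (R : realType) (m : nat) (a : 'M[R[i]]_m.+1)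
    (tau : 'rV[R]_m) :
  m.+1 = 2%N -> a^T = a -> sqnorm tau = 1 -> \det (Bmat a tau) = \det a.
Proof.
case: m a tau => [|[|//]] // a tau _ symA.
rewrite /sqnorm big_ord1 => tau1.
rewrite det_Bmat det_mx22 /coef_tt /coef_tn !big_ord1 /coef_nn.
have -> : lift ord_max 0 = 0 :> 'I_2 by exact: val_inj.
have -> : ord_max = 1 :> 'I_2 by exact: val_inj.
have -> : a 1 0 = a 0 1 by rewrite -{1}symA mxE.
have tau1' : (tau 0 0)%:C%C ^+ 2 = 1 by rewrite -rmorphXn tau1.
by rewrite exprMn tau1' mulr1 -(mulrA (a 0 0)) -(expr2 (tau 0 0)%:C%C) tau1'; ring.
Qed.

(** Makes the quantification over unit covectors nonvacuous, so that in the plane it yields the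
    single condition on the determinant of [A]. *)
Lemma exists_unit_covector (R : realType) (m : nat) : m.+1 = 2%N ->
  exists tau : 'rV[R]_m, sqnorm tau = 1.
Proof.
case: m => [|[|//]] // _; exists (const_mx 1).
by rewrite /sqnorm big_ord1 mxE expr1n.
Qed.

Theorem proposition2p5 (R : realType) (m : nat)
  (d23 : m.+1 = 2%N \/ m.+1 = 3%N)
  (O : set 'rV[R]_m.+1)
  (domO : bounded_domain O) (bdryO : C2_boundary O)
  (A : 'rV[R]_m.+1 -> 'M[R[i]]_m.+1)
  (smoothA : forall i j, smooth_on_closure O (fun x => A x i j))
  (symA : forall x : 'rV[R]_m.+1, closure O x -> (A x)^T = A x)
  (ellA : forall x : 'rV[R]_m.+1, closure O x -> elliptic (A x))
  (n : 'rV[R]_m.+1 -> R[i]) (smoothn : smooth_on_closure O n) (k : R[i])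
  (E : 'rV[R]_m.+1 -> 'M[R]_m.+1)
  (basisE : forall x0, bdry O x0 -> adapted_basis O x0 (E x0)) :
  shapiro_lopatinskii O A E <->
  (forall x0, bdry O x0 ->
     let a := local_coef (A x0) (E x0) in
     (m.+1 = 2%N ->
        \det (A x0) <> 1 \/ complex.Re (coef_nn a) < 0) /\
     (m.+1 = 3%N ->
        (forall tau : 'rV[R]_m, sqnorm tau = 1 -> \det (Bmat a tau) <> 1) \/
        complex.Re (coef_nn a) < 0)).
Proof.
have proper x0 : bdry O x0 -> properly_elliptic (local_coef (A x0) (E x0)).
  move=> bx; have [cx _] := bx; have [EE _] := basisE x0 bx.
  case: d23 => md.
  - by apply: properly_elliptic2 => //; [exact: symA|exact: ellA].
  - by apply: properly_elliptic3 => //; [exact: symA|exact: ellA].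
have pointwise x0 : bdry O x0 -> let a := local_coef (A x0) (E x0) in
    (forall tau, tau != 0 -> forall u v, frozen_solution a tau u v ->
       forall t : R, 0 <= t -> u t = 0 /\ v t = 0) <->
    (forall tau : 'rV[R]_m, sqnorm tau = 1 -> \det (Bmat a tau) <> 1) \/
      complex.Re (coef_nn a) < 0.
  move=> bx a.
  by rewrite frozen_problem_criterion ?unit_covector_criterion//; exact: proper.
have planar x0 : bdry O x0 -> m.+1 = 2%N ->
    let a := local_coef (A x0) (E x0) in
    (forall tau : 'rV[R]_m, sqnorm tau = 1 -> \det (Bmat a tau) <> 1) <->
    \det (A x0) <> 1.
  move=> bx m2 a; have [cx _] := bx; have [EE _] := basisE x0 bx.
  have detE tau : sqnorm tau = 1 -> \det (Bmat a tau) = \det (A x0).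
    move=> tau1; rewrite -(det_local_coef (symA x0 cx) EE).
    by apply: det_Bmat_planar => //; exact: local_coef_sym (symA x0 cx).
  split=> [H|H tau tau1]; last by rewrite detE.
  have [tau tau1] := exists_unit_covector R m2.
  by rewrite -(detE tau)//; exact: H.
split=> [SL x0 bx|H x0 bx].
  have cond := (pointwise x0 bx).1 (SL x0 bx).
  by split=> [m2|//]; move: cond; rewrite planar.
apply/pointwise => //; case: d23 => [m2|m3].
- by have [/(_ m2)] := H x0 bx; rewrite planar.
- by have [_ /(_ m3)] := H x0 bx.
Qed.
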